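(* If $2\le n\le 5$, then any maximum obtuse almost-equiangular set in $S^{n-1}$ is a double regular $n$-simplex.
   Context: $S^{n-1}=\{x\in\mathbb{R}^n:\|x\|=1\}$ and $x\cdot y$ is the Euclidean inner product. For $t\in[-1,1)$, a set $S\subseteq S^{n-1}$ is $t$-almost-equiangular if every three distinct points $x,y,z\in S$ satisfy $t\in\{x\cdot y,\,x\cdot z,\,y\cdot z\}$. A maximum obtuse almost-equiangular set in $S^{n-1}$ is a $(-1/n)$-almost-equiangular subset of $S^{n-1}$ with exactly $2(n+1)$ (distinct) points. Simplices are identified with their vertex sets: a regular $n$-simplex in $S^{n-1}$ is a set of $n+1$ points of $S^{n-1}$ with pairwise inner products $-1/n$. A double regular $n$-simplex is the union of two disjoint (i.e., having no common vertex) regular $n$-simplices in $S^{n-1}$. *)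

(* Defs.v *)
From HB Require Import structures.
From mathcomp Require Import all_boot all_order all_algebra.
From mathcomp Require Import boolp classical_sets functions cardinality reals.
Set Implicit Arguments.
Unset Strict Implicit.
Unset Printing Implicit Defensive.
Import Order.TTheory GRing.Theory Num.Theory.
Local Open Scope classical_set_scope.
Local Open Scope ring_scope.

Definition dotp (R : realType) (n : nat) (x y : 'rV[R]_n) : R :=
  \sum_(i < n) x 0 i * y 0 i.

(* The norm that MathComp-Analysis puts on row vectors is the sup norm, hence
   a separate Euclidean norm. *)
Definition enorm (R : realType) (n : nat) (x : 'rV[R]_n) : R :=
  Num.sqrt (dotp x x).

(* S^{n-1}, indexed by the dimension n of the ambient space. *)
Definition unit_sphere (R : realType) (n : nat) : set 'rV[R]_n :=
  [set x | enorm x = 1].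
Arguments unit_sphere : clear implicits.

Definition almost_equiangular (R : realType) (n : nat) (t : R)
    (S : set 'rV[R]_n) : Prop :=
  S `<=` unit_sphere R n /\
  forall x y z, S x -> S y -> S z -> x <> y -> x <> z -> y <> z ->
    [\/ dotp x y = t, dotp x z = t | dotp y z = t].

Definition max_obtuse_almost_equiangular (R : realType) (n : nat)
    (S : set 'rV[R]_n) : Prop :=
  almost_equiangular (- 1 / n%:R) S /\ (S #= `I_(2 * n.+1)%N)%card.

Definition regular_simplex (R : realType) (n : nat) (T : set 'rV[R]_n) : Prop :=
  [/\ T `<=` unit_sphere R n,
      (T #= `I_n.+1)%card &
      forall x y, T x -> T y -> x <> y -> dotp x y = - 1 / n%:R].

Definition double_regular_simplex (R : realType) (n : nat)
    (S : set 'rV[R]_n) : Prop :=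
  exists T1 T2 : set 'rV[R]_n,
    [/\ regular_simplex T1, regular_simplex T2,
        T1 `&` T2 = set0 & S = T1 `|` T2].

(* Main.v *)
Require Import Defs.
From mathcomp Require Import all_boot all_order all_algebra.
From mathcomp Require Import boolp classical_sets functions cardinality reals.
From mathcomp Require Import zify ring lra.

(** Let N = 2(n + 1), and join two points of S by an edge when their inner
    product is not -1/n; that S is almost-equiangular says that this graph has
    no triangle.  The matrix with entries (n <x, y> + 1) / (n + 1) is the Gram
    matrix of N unit vectors in dimension n + 1, namely the rescaled points of S
    with one more coordinate, which is constant.  It has the form I + A, where A vanishes on
    the diagonal and off the edges.

    Triangle-freeness gives tr A = tr A^3 = 0, so the n + 1 = N/2 eigenvalues
    mu of the frame operator of these vectors satisfy
    sum (mu - 2)^2 (mu + 1) = 0, and all of them are 2 ([tight_frame]).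
    Hence A is a symmetric orthogonal matrix, A^2 = I, and A fixes the constant
    vector.  If the graph has a proper two-colouring, then A^2 = I forces the
    two colour classes to have the same size n + 1 ([bipartite_halves]), and
    each of them is a regular simplex.

    It remains to exclude odd cycles, and here N <= 12 is used.  Orthogonality
    of the rows of A shows that two vertices with a common neighbour have a
    second one, and no vertex has exactly one neighbour since each row of A has
    sum 1 and no entry of A is equal to 1.  A shortest odd cycle, of length L, then has a twin beside each
    of its vertices, and these 2L vertices are distinct, so L = 5
    ([pentagon_of_odd_walk]).  The few vertices that are left over can be
    distributed so that the whole graph maps onto the pentagon
    ([pentagon_hom]).

    Such a blow-up of a pentagon cannot carry A ([blow_up_gt12]).  Between
    consecutive classes, the sum of the entries of A and the sum of their
    squares satisfy the same linear system, because rows have sum 1 and norm 1.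
    The solution consists of positive integers of total N/2 <= 6, so two
    consecutive ones are equal to 1, and the class between these has two
    vertices.  The block of A next to it defines a projection of rank 1 of the
    plane, which turns out to be diagonal, and so one of its vertices has no
    neighbour on one side, whereas the pentagon passes through it. *)

Set Implicit Arguments.
Unset Strict Implicit.
Unset Printing Implicit Defensive.
Import Order.TTheory GRing.Theory Num.Theory.

(** * Odd closed walks and two-colourings *)

Section OddWalks.
Variables (T : finType) (e : rel T).

Fixpoint walk (k : nat) (x y : T) : bool :=
  if k is k'.+1 then [exists z, e x z && walk k' z y] else x == y.

Lemma walk_cat k l x y z : walk k x y -> walk l y z -> walk (k + l) x z.
Proof.
elim: k x => [|k IHk] x /=; first by move/eqP->.
case/existsP=> w /andP[exw wy] yz; apply/existsP; exists w.
by rewrite exw IHk.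
Qed.

Lemma walk1 x y : e x y -> walk 1 x y.
Proof. by move=> exy; apply/existsP; exists y; rewrite exy /=. Qed.

Lemma walk_fun k x y : walk k x y ->
  exists u : nat -> T, [/\ u 0 = x, u k = y & forall i, i < k -> e (u i) (u i.+1)].
Proof.
elim: k x => [|k IHk] x /=; first by move/eqP->; exists (fun=> y).
case/existsP=> z /andP[exz /IHk[u [u0 uk ue]]].
exists (fun i => if i is i'.+1 then u i' else x); split=> // -[|i] //=.
  by rewrite u0.
exact: ue.
Qed.

Lemma walk_of_fun (u : nat -> T) : (forall i, e (u i) (u i.+1)) ->
  forall a b, a <= b -> walk (b - a) (u a) (u b).
Proof.
move=> ue a b /subnK; move: (b - a) => k <-{b}.
elim: k a => [|k IHk] a /=; first by rewrite add0n.
by apply/existsP; exists (u a.+1); rewrite ue addSnnS IHk.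
Qed.

(** Periodic indexing makes the segment of a cycle between any two positions,
    also across the base point, an ordinary interval of indices. *)
Lemma closed_walk_periodic k x : 0 < k -> walk k x x ->
  exists u : nat -> T,
    (forall i, u (i + k) = u i) /\ (forall i, e (u i) (u i.+1)).
Proof.
move=> k0 /walk_fun[u [u0 uk ue]]; exists (fun i => u (i %% k)); split=> i.
  by rewrite modnDr.
have ik := ltn_pmod i k0; rewrite (divn_eq i k) -addnS !modnMDl modn_mod.
have [ik1|] := ltnP (i %% k).+1 k; first by rewrite (modn_small ik1) ue.
move=> ki; have ki1 : (i %% k).+1 = k by lia.
by have := ue _ ik; rewrite ki1 modnn u0 uk.
Qed.

Hypothesis esym : symmetric e.

(** The bipartite double cover [T * bool] has an edge from (x, b) to (y, ~~ b)
    for each edge x y.  Without odd closed walks, the two sheets over a vertex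
    lie in different components, and the colour of x tells which of its two
    copies is joined to a fixed copy of the root of its component. *)
Lemma no_odd_closed_walk_bipartite :
    (forall k x, odd k -> ~~ walk k x x) ->
  exists c : T -> bool, forall x y, e x y -> c x != c y.
Proof.
move=> noodd.
pose d := fun p q : T * bool => e p.1 q.1 && (p.2 != q.2).
have dsym : connect_sym d.
  by apply: sym_connect_sym => p q; rewrite /d esym eq_sym.
have csym : connect_sym e by apply: sym_connect_sym.
have dwalk p q : connect d p q ->
    exists2 k, walk k p.1 q.1 & odd k = (p.2 != q.2).
  case/connectP=> s; elim: s p => [|r s IHs] p /=.
    by move=> _ ->; exists 0; rewrite /= eqxx.
  case/andP=> /andP[epr npr] /IHs{}IHs /IHs[k wk ok]; exists k.+1.
    by apply/existsP; exists r.1; rewrite epr.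
  by rewrite /= ok; case: (p.2) (q.2) (r.2) npr => [] [] [].
have sheets x : ~~ connect d (x, false) (x, true).
  apply/negP=> /dwalk[k wk ok].
  by move: (noodd k x); rewrite ok => /(_ isT)/negP.
have flip x y b b' : connect d (x, b) (y, b') -> connect d (x, ~~ b) (y, ~~ b').
  case/connectP=> s; elim: s x b => [|[z bz] s IHs] x b /=.
    by move=> _ [-> ->].
  case/andP=> ez /IHs{}IHs /IHs; apply: connect_trans; apply: connect1.
  by move: ez; rewrite /d /=; case: b bz {IHs} => [] [].
have lift x y : connect e x y -> exists b, connect d (x, false) (y, b).
  case/connectP=> s; elim: s x => [|z s IHs] x /=.
    by move=> _ ->; exists false.
  case/andP=> exz /IHs{}IHs /IHs[b zy]; exists (~~ b).
  apply: (connect_trans (connect1 _) (flip _ _ _ _ zy)).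
  by rewrite /d /= exz.
pose r x := fingraph.root e x.
have rP x : connect e (r x) x by rewrite csym connect_root.
exists (fun x => connect d (r x, false) (x, false)) => x y exy.
have -> : r y = r x by apply/eqP; rewrite eq_sym root_connect // connect1.
have step b : connect d (r x, false) (x, b) -> connect d (r x, false) (y, ~~ b).
  move/connect_trans; apply; apply: connect1.
  by rewrite /d /= exy; case: (b).
have notboth z : connect d (r x, false) (z, false) ->
    connect d (r x, false) (z, true) -> False.
  rewrite dsym => p q; exact: (negP (sheets z)) (connect_trans p q).
have [[] rb] := lift _ _ (rP x).
  rewrite (step true rb) eqb_id; apply/negP => rx; exact: notboth rx rb.
rewrite rb eq_sym eqb_id; apply/negP => ry; exact: notboth ry (step false rb).
Qed.
End OddWalks.

(** * The shortest odd cycle is a pentagon *)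

Section ShortOddCycle.
Variables (T : finType) (e : rel T).
Hypothesis esym : symmetric e.
Hypothesis triangle_free : forall x y z, e x y -> e y z -> ~~ e x z.
Hypothesis two_paths : forall x y z, x != y -> e x z -> e y z ->
  exists2 w, w != z & e x w && e y w.

(** On a shortest odd closed walk, a vertex adjacent to two positions is
    adjacent to positions at distance 2, for otherwise it would shorten the
    walk.  Thus the sets of common neighbours of the positions i and i + 2 are
    disjoint for different i, and each contains the vertex i + 1 together with
    a twin, so twice the length is at most 12. *)
Lemma pentagon_of_odd_walk k x : #|T| <= 12 -> odd k -> walk e k x x ->
  exists u : nat -> T, (forall i, u (i + 5) = u i) /\ (forall i, e (u i) (u i.+1)).
Proof.
move=> cardT ok wk.
have eirr z : e z z = false.
  by apply/negP => ez; have := triangle_free ez ez; rewrite ez.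
have exL : exists L, odd L && [exists z, walk e L z z].
  by exists k; rewrite ok; apply/existsP; exists x.
case: (ex_minnP exL) => L /andP[oL /existsP[z wL]] minL {exL k x ok wk}.
have {minL} minL l y : odd l -> walk e l y y -> L <= l.
  by move=> ol wl; apply: minL; rewrite ol; apply/existsP; exists y.
have L0 : 0 < L by case: L oL {wL minL}.
have [u [uL ue]] := closed_walk_periodic L0 wL.
have uw := walk_of_fun ue.
suff L5 : L = 5 by exists u; rewrite -{1}L5.
(* Length 1 is a loop and length 3 is a triangle. *)
have L4 : 4 < L.
  case: L oL uL {wL minL L0} => [|[|[|[|[|L]]]]] // _ uL.
    by have := ue 0; rewrite -(uL 0) addn1 eirr.
  by have := triangle_free (ue 0) (ue 1); rewrite esym -(uL 0) add0n ue.
(* A vertex y closes the segment from a to b, and also the complementary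
   segment from b to a + L; the one of odd length gives a shorter odd walk
   unless it has length L - 2 or more. *)
have chord a b y : a < b < a + L -> e y (u a) -> e y (u b) ->
    b - a = 2 \/ b - a = L - 2.
  move=> /andP[ab bL] ya yb.
  have closed i j : i <= j -> e y (u i) -> e y (u j) -> odd (j - i) ->
      L <= j - i + 2.
    move=> ij yi yj oij; apply: (minL _ y); first by rewrite addn2 /= negbK.
    have := walk_cat (walk_cat (walk1 yi) (uw i j ij)) (walk1 (_ : e (u j) y)).
    rewrite add1n addn1 -addn2; apply; by rewrite esym.
  have [oba|eba] := boolP (odd (b - a)).
    have := closed a b (ltnW ab) ya yb oba; lia.
  have := closed b (a + L) (ltnW bL) yb; rewrite uL => /(_ ya); lia.
have turn i : u i != u i.+2.
  apply/eqP => ui; suff : L <= L - 2 by lia.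
  apply: (minL _ (u i.+2)); first by lia.
  have -> : L - 2 = i + L - i.+2 by lia.
  rewrite -{2}ui -(uL i); apply: uw; lia.
(* The neighbours i, i + 2, j, j + 2 of y are at least three positions, which
   cannot be pairwise at distance 2 along a cycle of odd length. *)
have disj i j y : i < j < i + L -> e y (u i) -> e y (u i.+2) ->
    e y (u j) -> e y (u j.+2) -> False.
  move=> ij yi yi2 yj yj2.
  case: (chord i j y ij yi yj) => dij.
    by have := chord i j.+2 y _ yi yj2; lia.
  by have := chord i.+2 j y _ yi2 yj; lia.
have ex_twin i : exists w, [&& w != u i.+1, e (u i) w & e (u i.+2) w].
  have [|w] := two_paths (turn i) (ue i) (_ : e (u i.+2) (u i.+1)).
    by rewrite esym.
  by move=> nw /andP[iw i2w]; exists w; rewrite nw iw.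
pose twin i := xchoose (ex_twin i).
have twinP i : [&& twin i != u i.+1, e (u i) (twin i) & e (u i.+2) (twin i)].
  exact: xchooseP (ex_twin i).
(* [f] lists the positions i + 1 of the walk and their twins. *)
pose f (p : 'I_L * bool) := if p.2 then u p.1.+1 else twin p.1.
have fV p : e (f p) (u p.1) && e (f p) (u p.1.+2).
  rewrite ![e (f p) _]esym /f; case: p => i [] /=.
    by rewrite ue esym ue.
  by case/and3P: (twinP i) => _ -> ->.
have f_inj : injective f.
  move=> p q fpq; have /andP[p1 p2] := fV p; have /andP[] := fV q.
  rewrite -fpq => q1 q2.
  have ep : p.1 = q.1.
    have := ltn_ord p.1; have := ltn_ord q.1 => qL pL.
    apply/val_inj => /=; case: (ltngtP p.1 q.1) => // lt.
      by case: (disj _ _ _ _ p1 p2 q1 q2); lia.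
    by case: (disj _ _ _ _ q1 q2 p1 p2); lia.
  case: p q ep fpq {p1 p2 q1 q2} => [i b] [j c] /= <-{j} /eqP.
  have /and3P[ti _ _] := twinP i; rewrite /f /=.
  by case: b; case: c => //; rewrite ?(negPf ti) // eq_sym (negPf ti).
have := leq_card f f_inj; rewrite card_prod card_bool card_ord; lia.
Qed.
End ShortOddCycle.

(** * Graphs on twelve vertices that contain a pentagon *)

Definition adj5 (i j : 'I_5) := (j == i + 1)%R || (i == j + 1)%R.

(** Statements on the pentagon [adj5] are checked on all its vertices. *)
Ltac ord5 i := move: i => [[|[|[|[|[|//]]]]] ?] //.

Lemma adj5_sym : symmetric adj5.
Proof. by move=> i j; rewrite /adj5 orbC. Qed.

Lemma adj5_succ i : adj5 i (i + 1)%R.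
Proof. by rewrite /adj5 eqxx. Qed.

Lemma adj5_pred i : adj5 i (i - 1)%R.
Proof. by rewrite /adj5 subrK eqxx orbT. Qed.

Lemma pred5_neq_succ (i : 'I_5) : (i - 1)%R != (i + 1)%R.
Proof. by ord5 i. Qed.

Lemma adj5_common i j : ~~ adj5 i j -> exists k, adj5 i k && adj5 j k.
Proof.
move=> nij; exists (if j == i + 2 then i + 1 else i - 1)%R.
by move: nij; ord5 i; ord5 j.
Qed.

Lemma adj5_neq i j : i != j -> exists k l, [&& adj5 i k, adj5 j l & adj5 k l].
Proof.
move=> nij; exists (if j == i + 2 then i - 1 else if j == i - 2 then i + 1 else j)%R.
exists (if j == i + 2 then i - 2 else if j == i - 2 then i + 2 else i)%R.
by move: nij; ord5 i; ord5 j.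
Qed.

Lemma adj5_middle i j k l :
  adj5 i j -> adj5 j k -> k != i -> adj5 i l -> adj5 l k -> l = j.
Proof.
move=> ij jk ki il lk; apply/eqP; move: ij jk ki il lk.
by ord5 i; ord5 j; ord5 k; ord5 l.
Qed.

(** The path l, i, j, k of the pentagon closes up through its fifth vertex m. *)
Lemma adj5_around i j : adj5 i j -> exists k l m,
  [/\ adj5 j k && (k != i), adj5 i l && (l != j) &
      forall h, adj5 m h -> h = k \/ h = l].
Proof.
move=> ij; exists (j + (j - i))%R, (i - (j - i))%R, (i - (j - i) - (j - i))%R.
split; [| |move=> h mh; apply/pred2P; move: mh]; move: ij.
- by ord5 i; ord5 j.
- by ord5 i; ord5 j.
- by ord5 i; ord5 j; ord5 h.
Qed.

Lemma adj5_independent (t : pred 'I_5) :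
    (forall i j, t i -> t j -> ~~ adj5 i j) ->
  exists c, forall i, t i -> adj5 i c.
Proof.
move=> indep; have [i ti|t0] := pickP t; last by exists 0%R => i; rewrite t0.
exists (if t (i + 2) then i + 1 else i - 1)%R => j tj.
have := indep _ _ ti tj; have := indep (i + 2)%R j; case: ifP => [ti2|nti2].
  move=> /(_ isT tj); clear; by ord5 i; ord5 j.
move=> _; have: j != (i + 2)%R by apply: contraFneq nti2 => <-.
by clear; ord5 i; ord5 j.
Qed.

(** If i and j were the two different neighbours of c, then k and l would be
    the two vertices opposite to c, which are adjacent and therefore have no
    common neighbour d. *)
Lemma adj5_far c i j k l d : adj5 i c -> adj5 j c -> adj5 i k -> adj5 j l ->
  k != c -> l != c -> adj5 k d -> adj5 l d -> i = j.
Proof.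
move=> ic jc ik jl kc lc kd ld; apply/eqP; move: ic jc ik jl kc lc kd ld.
by ord5 c; ord5 i; ord5 j; ord5 k; ord5 l; ord5 d.
Qed.

Lemma card_gt2 (T : finType) (A : {set T}) x y z : x \in A -> y \in A -> z \in A ->
  x != y -> x != z -> y != z -> 2 < #|A|.
Proof.
move=> xA yA zA xy xz yz; rewrite cardE.
apply: (@uniq_leq_size _ [:: x; y; z]).
  by rewrite /= !inE negb_or xy xz yz.
by move=> t; rewrite !inE mem_enum => /or3P[] /eqP->.
Qed.

Section Pentagon.
Variables (T : finType) (e : rel T).
Hypothesis esym : symmetric e.
Hypothesis triangle_free : forall x y z, e x y -> e y z -> ~~ e x z.
Hypothesis two_paths : forall x y z, x != y -> e x z -> e y z ->
  exists2 w, w != z & e x w && e y w.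
Hypothesis no_leaf : forall x y, e x y -> exists2 z, z != y & e x z.
Hypothesis cardT : #|T| <= 12.

Variable u : 'I_5 -> T.
Hypothesis ue : forall i, e (u i) (u (i + 1)%R).

Lemma eirr z : e z z = false.
Proof. by apply/negP => ez; have := triangle_free ez ez; rewrite ez. Qed.

Lemma u_adj i j : adj5 i j -> e (u i) (u j).
Proof. by case/orP=> /eqP->; rewrite // esym. Qed.

(** The vertices that may replace [u i] in the pentagon [u]. *)
Definition twins i := [set x | e x (u (i - 1)%R) && e x (u (i + 1)%R)].
Definition rest := [set x | [forall i, x \notin twins i]].

Lemma twinsP i x : reflect (forall k, adj5 i k -> e x (u k)) (x \in twins i).
Proof.
rewrite inE; apply: (iffP andP) => [[x1 x2] k|H].
  by case/orP=> /eqP; [move->|move=> ik; rewrite ik addrK in x1].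
by split; apply: H; rewrite /adj5 ?eqxx ?orbT // subrK eqxx orbT.
Qed.

Lemma cycle_twins i : u i \in twins i.
Proof. by apply/twinsP=> k /u_adj. Qed.

(** Positions at distance 0 or 2 in the pentagon have a common neighbour
    [u k], which would complete x and y to a triangle. *)
Lemma twins_adj i j x y : x \in twins i -> y \in twins j -> e x y -> adj5 i j.
Proof.
move=> /twinsP xi /twinsP yj exy; apply: contraLR isT => /adj5_common[k /andP[ik jk]].
by apply/negP => _; have := triangle_free exy (yj k jk); rewrite xi.
Qed.

Lemma twins_inj i j x : x \in twins i -> x \in twins j -> i = j.
Proof.
move=> /twinsP xi /twinsP xj; apply/eqP; apply: contraT.
case/adj5_neq=> [k [l /and3P[ik jl kl]]].
by have := triangle_free (xi k ik) (u_adj kl); rewrite xj.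
Qed.

Lemma restPn x : reflect (exists i, x \in twins i) (x \notin rest).
Proof.
rewrite inE negb_forall; apply: (iffP existsP) => -[i];
  by exists i; rewrite ?negbK // in p *.
Qed.

(** Besides [u i], the second common neighbour of [u (i - 1)] and
    [u (i + 1)] belongs to this class. *)
Lemma card_twins i : 1 < #|twins i|.
Proof.
have nu : u (i - 1)%R != u (i + 1)%R.
  apply/eqP => uu; have := cycle_twins (i - 1)%R; rewrite uu.
  move=> /twins_inj /(_ (cycle_twins _)) /eqP.
  exact/negP/pred5_neq_succ.
have [w nw /andP[w1 w2]] : exists2 w, w != u i & e (u (i - 1)%R) w && e (u (i + 1)%R) w.
  by apply: two_paths => //; apply: u_adj; rewrite adj5_sym ?adj5_succ ?adj5_pred.
have -> : 2 = #|[set w; u i]| by rewrite cards2 nw.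
apply: subset_leq_card; apply/fintype.subsetP=> x /set2P[->|->];
  by rewrite ?cycle_twins // inE !(esym w) w1.
Qed.

Lemma card_rest_twins : #|rest| + \sum_i #|twins i| <= 12.
Proof.
apply: leq_trans cardT.
have cardE (A : {set T}) : #|A| = \sum_x (if x \in A then 1 else 0).
  by rewrite -sum1_card big_mkcond.
rewrite cardE (eq_bigr _ (fun i _ => cardE (twins i))) exchange_big -big_split /=.
rewrite -sum1_card; apply: leq_sum => x _.
have [xW|/restPn[i xi]] := boolP (x \in rest).
  rewrite big1 // => i _; case: ifP => // xi.
  by move: xW; rewrite inE => /forallP/(_ i); rewrite xi.
rewrite (bigD1 i) //= xi big1 // => j ji; case: ifP => // xj.
by rewrite (twins_inj xi xj) eqxx in ji.
Qed.

(** Five disjoint classes with two or more elements leave room for two. *)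
Lemma card_rest : #|rest| <= 2.
Proof.
have := card_rest_twins; have : \sum_(i : 'I_5) 2 <= \sum_i #|twins i|.
  by apply: leq_sum => i _; apply: card_twins.
rewrite sum_nat_const card_ord; lia.
Qed.

Lemma small_twins w i j : w \in rest -> i != j -> #|twins i| <= 2 \/ #|twins j| <= 2.
Proof.
move=> wW ij; have w1 : 0 < #|rest| by apply/card_gt0P; exists w.
pose s := \sum_(k | (k != i) && (k != j)) #|twins k|.
have tot : #|rest| + (#|twins i| + (#|twins j| + s)) <= 12.
  by have := card_rest_twins; rewrite (bigD1 i) //= (bigD1 j) 1?eq_sym.
have : \sum_(k | (k != i) && (k != j)) 2 <= s.
  by apply: leq_sum => k _; apply: card_twins.
rewrite sum_nat_const.
have -> : #|[pred k | (k != i) && (k != j)]| = 3.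
  have := cardC (pred2 i j); rewrite card2 ij card_ord => /= -[c3].
  by apply: etrans c3; apply: eq_card => k; rewrite !inE negb_or.
lia.
Qed.

Lemma small_twins2 w w' i : w \in rest -> w' \in rest -> w != w' -> #|twins i| <= 2.
Proof.
move=> wW w'W ww'; have w2 : 1 < #|rest|.
  have -> : 2 = #|[set w; w']| by rewrite cards2 ww'.
  by apply: subset_leq_card; apply/fintype.subsetP=> x /set2P[]->.
pose s := \sum_(k | k != i) #|twins k|.
have tot : #|rest| + (#|twins i| + s) <= 12 by have := card_rest_twins; rewrite (bigD1 i).
have : \sum_(k | k != i) 2 <= s by apply: leq_sum => k _; apply: card_twins.
rewrite sum_nat_const.
have -> : #|[pred k | k != i]| = 4 by have := cardC1 i; rewrite card_ord.
lia.
Qed.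

(** The vertices x and [u k] have the common neighbour [u j], hence a second
    one.  It lies in the class of j or outside all classes, and the former is
    excluded when this class is reduced to [u j] and y. *)
Lemma missing_edge i j k x y : adj5 i j -> adj5 j k -> k != i ->
    x \in twins i -> y \in twins j -> ~~ e x y -> #|twins j| <= 2 ->
  exists2 w, w \in rest & e w x && e w (u k).
Proof.
move=> ij jk ki xi yj nxy Vj.
have xuk : x != u k.
  by apply: contraNneq ki => xk; rewrite xk in xi; rewrite (twins_inj xi (cycle_twins k)).
have xuj : e x (u j) by move/twinsP: xi; apply.
have [z zuj /andP[xz kz]] : exists2 z, z != u j & e x z && e (u k) z.
  by apply: two_paths => //; apply: u_adj; rewrite adj5_sym.
have [zW|/restPn[l zl]] := boolP (z \in rest); first by exists z; rewrite // !(esym z) xz.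
have lj : l = j.
  apply: (adj5_middle ij jk ki (twins_adj xi zl xz)).
  by rewrite adj5_sym; apply: twins_adj (cycle_twins k) zl kz.
rewrite {}lj in zl.
have yuj : y != u j by apply: contraNneq nxy => ->.
have zy : z != y by apply: contraNneq nxy => <-.
by move: Vj; rewrite leqNgt (card_gt2 zl yj (cycle_twins j)).
Qed.

(** The vertex w may be given the colour c, as far as its neighbours in the
    twin classes are concerned. *)
Definition fits w c := forall i x, x \in twins i -> e w x -> adj5 i c.

(** A vertex w fits no colour only if it has neighbours x and y in consecutive
    classes i and j.  Then x and y are not adjacent, and [missing_edge] yields
    a second leftover vertex; both classes are now as small as possible, and
    [missing_edge] applies on both sides to this same vertex, which would then
    be adjacent to [u k] and [u l] and belong to the class between them. *)
Lemma rest_fits w : w \in rest -> exists c, fits w c.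
Proof.
move=> wW; pose t i := [exists x in twins i, e w x].
suff /adj5_independent[c tc] : forall i j, t i -> t j -> ~~ adj5 i j.
  by exists c => i x xi wx; apply: tc; apply/existsP; exists x; rewrite xi.
move=> i j /existsP[x /andP[xi wx]] /existsP[y /andP[yj wy]]; apply/negP => ij.
have nxy : ~~ e x y by apply: triangle_free wy; rewrite esym.
have [k [l [m [/andP[jk ki] /andP[il lj] nm]]]] := adj5_around ij.
have nij : i != j by move: ij; clear; ord5 i; ord5 j.
have ji : adj5 j i by rewrite adj5_sym.
have right : #|twins j| <= 2 -> exists2 w', w' \in rest & (w' != w) && e w' (u k).
  case/(missing_edge ij jk ki xi yj nxy) => w' w'W /andP[w'x w'k]; exists w' => //.
  rewrite w'k andbT; apply: contraTneq w'k => ->.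
  by apply: triangle_free wy _; move/twinsP: yj; apply.
have left : #|twins i| <= 2 -> exists2 w', w' \in rest & (w' != w) && e w' (u l).
  rewrite esym in nxy.
  case/(missing_edge ji il lj yj xi nxy) => w' w'W /andP[w'x w'l]; exists w' => //.
  rewrite w'l andbT; apply: contraTneq w'l => ->.
  by apply: triangle_free wx _; move/twinsP: xi; apply.
have small h : #|twins h| <= 2.
  case: (small_twins wW nij) => [/left|/right] [w' w'W /andP[w'w _]];
    exact: small_twins2 w'W wW w'w.
have [w1 w1W /andP[w1w w1k]] := right (small j).
have [w2 w2W /andP[w2w w2l]] := left (small i).
have w12 : w1 = w2.
  apply: contraTeq card_rest => n12.
  by rewrite -ltnNge (card_gt2 w1W w2W wW).
have : w1 \in twins m.
  by apply/twinsP => h /nm[]->; rewrite // w12.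
by move: w1W; rewrite inE => /forallP/(_ m)/negP.
Qed.

Lemma rest_pair w w' : w \in rest -> w' \in rest -> w != w' ->
  forall z, z \in rest -> z = w \/ z = w'.
Proof.
move=> wW w'W nww' z zW; apply/pred2P; apply: contraTT card_rest; rewrite negb_or.
by case/andP=> zw zw'; rewrite -ltnNge (card_gt2 zW wW w'W).
Qed.

(** When two leftover vertices w and w' are adjacent, every neighbour x of w
    in a class is, like w', a neighbour of w, so x and w' have a further common
    neighbour.  Hence each class met by w is next to a class met by w', and
    some class met by w' is next to all classes met by w; its index is a colour
    for w, adjacent to any colour that fits w'. *)
Lemma rest_fits_edge w w' : w \in rest -> w' \in rest -> e w w' ->
  exists c d, [/\ fits w c, fits w' d & adj5 c d].
Proof.
move=> wW w'W ww'.
have nww' : w != w' by apply: contraTneq ww' => ->; rewrite eirr.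
have Wonly := rest_pair wW w'W nww'.
have [c wc] := rest_fits wW; have [d w'd] := rest_fits w'W.
have step i x : x \in twins i -> e w x ->
    exists k y, [/\ y \in twins k, e w' y & adj5 i k].
  move=> xi wx; have nx : w' != x.
    apply: contraTneq xi => <-; move: w'W; rewrite inE => /forallP; exact.
  have [y nyw /andP[w'y xy]] : exists2 y, y != w & e w' y && e x y.
    by apply: two_paths; rewrite // esym.
  have [/Wonly[]yw|/restPn[k yk]] := boolP (y \in rest).
  - by rewrite yw eqxx in nyw.
  - by rewrite yw eirr in w'y.
  by exists k, y; split=> //; apply: twins_adj xi yk xy.
suff [c0 [wc0 [y [yc0 w'y]]]] :
    exists c0, fits w c0 /\ exists y, y \in twins c0 /\ e w' y.
  by exists c0, d; split=> //; apply: w'd yc0 w'y.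
have [z nz wz] := no_leaf ww'.
have [/Wonly[]zw|/restPn[j zj]] := boolP (z \in rest).
- by rewrite zw eirr in wz.
- by rewrite zw eqxx in nz.
have [/existsP[y /andP[yc w'y]]|nc] := boolP [exists y in twins c, e w' y].
  by exists c; split=> //; exists y.
have notc k y : y \in twins k -> e w' y -> k != c.
  move=> yk w'y; apply: contraNneq nc => <-; apply/existsP; exists y.
  by rewrite yk.
have [k [y [yk w'y jk]]] := step j z zj wz.
exists k; split; last by exists y.
move=> i x xi wx; have [l [y' [yl w'y' il]]] := step i x xi wx.
have -> // : i = j.
exact: (adj5_far (wc i x xi wx) (wc j z zj wz) il jk (notc _ _ yl w'y')
                 (notc _ _ yk w'y) (w'd _ _ yl w'y') (w'd _ _ yk w'y)).
Qed.

(** Each twin class gets the colour of its index.  Leftover vertices get a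
    colour that fits, and these choices interact only on an edge between two
    leftover vertices, the case of [rest_fits_edge]. *)
Lemma pentagon_hom :
  exists c : T -> 'I_5, (forall i, c (u i) = i) /\
    forall x y, e x y -> adj5 (c x) (c y).
Proof.
have /fin_all_exists[c cP] x :
    exists c, fits x c /\ forall i, x \in twins i -> c = i.
  have [xW|/restPn[i xi]] := boolP (x \in rest).
    have [c xc] := rest_fits xW; exists c; split=> // i xi.
    by move: xW; rewrite inE => /forallP/(_ i); rewrite xi.
  exists i; split; last by move=> j; apply: twins_inj.
  by move=> j y yj xy; apply: twins_adj yj xi _; rewrite esym.
have glue (c' : T -> 'I_5) : (forall x, x \notin rest -> c' x = c x) ->
    (forall x, fits x (c' x)) ->
    (forall x y, x \in rest -> y \in rest -> e x y -> adj5 (c' x) (c' y)) ->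
    exists c : T -> 'I_5, (forall i, c (u i) = i) /\
      forall x y, e x y -> adj5 (c x) (c y).
  move=> c'V c'fit c'W; exists c'; split=> [i|x y xy].
    rewrite c'V; first exact: (cP _).2 (cycle_twins i).
    by apply/restPn; exists i; apply: cycle_twins.
  have [xW|nxW] := boolP (x \in rest); last first.
    have /restPn[i xi] := nxW; rewrite (c'V x) // ((cP x).2 i xi).
    by apply: (c'fit y) xi _; rewrite esym.
  have [yW|nyW] := boolP (y \in rest); first exact: c'W.
  have /restPn[j yj] := nyW; rewrite (c'V y) // ((cP y).2 j yj) adj5_sym.
  exact: (c'fit x) yj xy.
have [/existsP[[w w'] /= /and3P[wW w'W ww']]|nWW] :=
  boolP [exists p : T * T, [&& p.1 \in rest, p.2 \in rest & e p.1 p.2]]; last first.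
  apply: (glue c) => // [x|x y xW yW xy]; first by case: (cP x).
  by case/existsP: nWW; exists (x, y); rewrite /= xW yW.
have [c1 [d1 [wc w'd cd]]] := rest_fits_edge wW w'W ww'.
have nww' : w' != w by apply: contraTneq ww' => ->; rewrite eirr.
have Wonly := rest_pair w'W wW nww'.
apply: (glue (fun x => if x == w then c1 else if x == w' then d1 else c x)).
- by move=> x xW; do 2?[case: eqVneq => [xw|_]; first by rewrite xw ?wW ?w'W in xW].
- move=> x; case: eqVneq => [->|_] //; case: eqVneq => [->|_] //.
  by case: (cP x).
move=> x y /Wonly[]-> /Wonly[]->; rewrite ?eirr // !eqxx (negPf nww') => _ //.
by rewrite adj5_sym.
Qed.
End Pentagon.

(** * Weighted blow-ups of a pentagon *)

Local Open Scope ring_scope.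

Lemma sum_pentagon (M : nmodType) (f : 'I_5 -> M) (i : 'I_5) :
  \sum_j f j = f i + f (i + 1) + f (i + 2) + f (i + 3) + f (i + 4).
Proof.
rewrite (reindex_inj (addrI i)) /= !big_ord_recl big_ord0 2!addr0 ![in LHS]addrA.
by congr (f _ + f _ + f _ + f _ + f _); clear f; apply/eqP; ord5 i.
Qed.

(** Of the disjoint pairs of consecutive indices 0, 1 and 2, 3, one has values
    1 and 1, since otherwise the total would be at least 3 + 3 + 1. *)
Lemma pentagon_ones (f : 'I_5 -> nat) : (forall i, 0 < f i)%N ->
  (\sum_i f i <= 6)%N -> exists i, f i = 1%N /\ f (i + 1) = 1%N.
Proof.
move=> f0; rewrite (sum_pentagon f 0) !add0r => sf.
have := f0 0; have := f0 1; have := f0 2; have := f0 3; have := f0 4.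
have [f01|nf01] := boolP ((f 0 == 1%N) && (f 1 == 1%N)).
  by exists 0; case/andP: f01 => /eqP-> /eqP; rewrite add0r => ->.
have [f23|nf23] := boolP ((f 2 == 1%N) && (f 3 == 1%N)).
  exists 2; case/andP: f23 => /eqP-> /eqP f3; split=> //.
  by rewrite -[RHS]f3; congr f; apply/eqP.
have sf' : (f 0%R + f 1%R + f 2%R + f 3%R + f 4%R <= 6)%N by [].
lia.
Qed.

Lemma adj5_between i j : adj5 i j -> adj5 j (i + 2) -> j = i + 1.
Proof. by move=> ij jk; apply/eqP; move: ij jk; ord5 i; ord5 j. Qed.

Lemma pred5_shift (i : 'I_5) : [/\ i + 1 - 1 = i, i + 2 - 1 = i + 1,
  i + 3 - 1 = i + 2, i + 4 - 1 = i + 3 & i - 1 = i + 4].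
Proof. by split; apply/eqP; ord5 i. Qed.

Section BlowUp.
Variables (R : realFieldType) (T : finType) (c : T -> 'I_5).

Definition flow (F : T -> T -> R) i :=
  \sum_(x | c x == i) \sum_(y | c y == i + 1) F x y.

Lemma sum_nbr (F : T -> R) i : (forall y, F y != 0 -> adj5 i (c y)) ->
  \sum_y F y = \sum_(y | c y == i + 1) F y + \sum_(y | c y == i - 1) F y.
Proof.
move=> Fi; rewrite (bigID (fun y => c y == i + 1)) /=; congr (_ + _).
rewrite (bigID (fun y => c y == i - 1)) /= addrC big1 => [|y /andP[n1 n2]].
  rewrite add0r; apply: eq_bigl => y; case: (eqVneq (c y) (i - 1)) => [->|_].
    by rewrite pred5_neq_succ.
  by rewrite andbF.
apply/eqP; apply: contraT => /Fi; rewrite /adj5 (negPf n1) /= => /eqP ij.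
by rewrite ij addrK eqxx in n2.
Qed.

Definition part i := #|[set x | c x == i]|.

Lemma sum_part : (\sum_i part i = #|T|)%N.
Proof.
rewrite -sum1_card (partition_big c predT) //=; apply: eq_bigr => i _.
by rewrite sum1dep_card.
Qed.

Lemma flowD (F : T -> T -> R) : (forall x y, F x y = F y x) ->
    (forall x y, F x y != 0 -> adj5 (c x) (c y)) ->
    (forall x, \sum_y F x y = 1) ->
  forall i, flow F i + flow F (i - 1) = (part i)%:R.
Proof.
move=> Fsym Fadj Frow i; rewrite /flow subrK [X in _ + X]exchange_big -big_split /=.
rewrite /part -sum1dep_card natr_sum; apply: eq_bigr => x /eqP xi.
rewrite -(Frow x) (sum_nbr (i := i)) => [|y]; last by rewrite -xi; apply: Fadj.
by congr (_ + _); apply: eq_bigr => y _; rewrite Fsym.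
Qed.

(** An odd cyclic system: the sum of two consecutive unknowns is known, so
    each of the five is half an alternating sum. *)
Lemma flowE F k : (forall x y, F x y = F y x) ->
    (forall x y, F x y != 0 -> adj5 (c x) (c y)) ->
    (forall x, \sum_y F x y = 1) -> #|T| = (2 * k)%N ->
  forall i, flow F i = k%:R - (part (i + 2))%:R - (part (i + 4))%:R.
Proof.
move=> Fsym Fadj Frow cT i; have FD := flowD Fsym Fadj Frow.
have := congr1 (fun m => m%:R : R) sum_part.
rewrite natr_sum cT natrM (sum_pentagon _ i) -!FD.
have [-> -> -> -> ->] := pred5_shift i; lra.
Qed.

Variable A : T -> T -> R.
Hypothesis Asym : forall x y, A x y = A y x.
Hypothesis Asq : forall x y, \sum_z A x z * A z y = (x == y)%:R.
Hypothesis Arow : forall x, \sum_y A x y = 1.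
Hypothesis Aadj : forall x y, A x y != 0 -> adj5 (c x) (c y).

(** The (x, x') entry of B B^T, where B is the block of A between the classes
    i and i + 1; since A^2 = I, it is an orthogonal projection of R^(class i). *)
Definition proj i x x' := \sum_(y | c y == i + 1) A x y * A x' y.

(** From class i to class i + 1 and back, the step of A back to class i may be
    replaced by all of A: the part of it that goes on to class i + 2 adds up to
    entries of A^2 between the classes i and i + 2, which vanish. *)
Lemma projE i x (f : T -> R) : c x = i ->
  \sum_(x' | c x' == i) proj i x x' * f x' =
  \sum_(y | c y == i + 1) A x y * \sum_z A y z * f z.
Proof.
move=> xi.
have -> : \sum_(x' | c x' == i) proj i x x' * f x' =
    \sum_(y | c y == i + 1) A x y * \sum_(z | c z == i) A y z * f z.
  under eq_bigr do rewrite /proj mulr_suml.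
  rewrite exchange_big; apply: eq_bigr => y _; rewrite mulr_sumr.
  by apply: eq_bigr => z _; rewrite (Asym z) mulrA.
have far : \sum_(y | c y == i + 1) A x y * \sum_(z | c z == i + 2) A y z * f z = 0.
  under eq_bigr do rewrite mulr_sumr.
  rewrite exchange_big big1 // => z /eqP zi.
  under eq_bigr do rewrite mulrA.
  have xz : x != z by apply/eqP => xz; move: zi; rewrite -xz xi; clear; move/eqP; ord5 i.
  rewrite -mulr_suml; suff -> : \sum_(y | c y == i + 1) A x y * A y z = 0.
    by rewrite mul0r.
  have := Asq x z; rewrite (negPf xz) (bigID (fun y => c y == i + 1)) /=.
  rewrite [X in _ + X]big1 ?addr0 // => y ny.
  apply/eqP; apply: contraNT ny; rewrite mulf_eq0 negb_or.
  case/andP=> /Aadj xy /Aadj yz; apply/eqP/adj5_between; first by rewrite -xi.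
  by rewrite -zi.
rewrite -[LHS]addr0 -[X in _ + X]far -big_split; apply: eq_bigr => y /eqP yi /=.
rewrite -mulrDr; congr (_ * _).
rewrite (sum_nbr (i := i + 1)) => [|z].
  by rewrite addrK addrC -addrA.
by rewrite mulf_eq0 negb_or -yi => /andP[/Aadj].
Qed.

Variable u : 'I_5 -> T.
Hypothesis cu : forall i, c (u i) = i.
Hypothesis Au : forall i, A (u i) (u (i + 1)) != 0.

(** Entries of A and their squares have the same row sums, so their flows are
    equal; this forces the off-diagonal entry of the 2 by 2 projection [proj j]
    to vanish.  Its entry at [u j] is then 1, which leaves no weight for the
    neighbour of [u j] in the class on the other side. *)
Lemma blow_up_gt12 k : #|T| = (2 * k)%N -> (6 < k)%N.
Proof.
move=> cT; rewrite ltnNge; apply/negP => k6.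
pose Q x y := A x y ^+ 2.
have Qsym x y : Q x y = Q y x by rewrite /Q Asym.
have Qadj x y : Q x y != 0 -> adj5 (c x) (c y).
  by rewrite /Q expf_eq0 /=; apply: Aadj.
have Qrow x : \sum_y Q x y = 1.
  transitivity ((x == x)%:R : R); last by rewrite eqxx.
  rewrite -Asq; apply: eq_bigr => y _.
  by rewrite /Q expr2 (Asym y).
have flowA := flowE Asym Aadj Arow cT.
have flowQ := flowE Qsym Qadj Qrow cT.
have flow_gt0 i : 0 < flow Q i.
  rewrite /flow (bigD1 (u i)) ?cu //= (bigD1 (u (i + 1))) ?cu //=.
  have Q0 x y : 0 <= Q x y by apply: sqr_ge0.
  rewrite -addrA ltr_pwDl ?exprn_even_gt0 //=.
  by rewrite addr_ge0 ?sumr_ge0 // => x _; apply: sumr_ge0.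
pose t i := (k - part (i + 2)%R - part (i + 4)%R)%N.
have tE i : flow Q i = (t i)%:R /\ (0 < t i)%N.
  have := flow_gt0 i; rewrite flowQ -addrA -opprD -natrD subr_gt0 ltr_nat => lt.
  by rewrite -natrB ?(ltnW lt) // /t -subnDA subn_gt0.
have sum_t : (\sum_i t i <= 6)%N.
  suff -> : (\sum_i t i = k)%N by [].
  apply/eqP; rewrite -(eqn_pmul2l (isT : 0 < 2)%N) -cT -sum_part.
  rewrite -(eqr_nat R) natrM !natr_sum mulr_natl mulr2n; apply/eqP.
  rewrite -(eq_bigr _ (fun i _ => (tE i).1)).
  rewrite {2}(reindex_inj (addIr (-1 : 'I_5))) -big_split /=.
  by apply: eq_bigr => i _; rewrite (flowD Qsym Qadj Qrow).
have [i [ti tj]] := pentagon_ones (fun i => (tE i).2) sum_t.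
set j := i + 1 in tj.
have ji : j - 1 = i by rewrite /j addrK.
have partj : part j = 2%N.
  apply/eqP; rewrite -(eqr_nat R) -(flowD Qsym Qadj Qrow) ji !(tE _).1 ti tj.
  by rewrite -natrD.
have [v vu Vj] : exists2 v, v != u j & [set x | c x == j] = [set u j; v].
  have Suj : u j \in [set x | c x == j] by rewrite inE cu.
  have := cardsD1 (u j) [set x | c x == j]; rewrite Suj -/(part j) partj.
  case=> /esym/eqP/cards1P[v Sv]; exists v; last by rewrite -Sv finset.setD1K.
  have : v \in [set x | c x == j] :\ u j by rewrite Sv set11.
  by rewrite in_setD1 => /andP[].
have sumV (F : T -> R) : \sum_(x | c x == j) F x = F (u j) + F v.
  transitivity (\sum_(x in [set x | c x == j]) F x).
    by apply: eq_bigl => x; rewrite inE.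
  by rewrite Vj big_setU1 ?big_set1 // inE eq_sym.
have cv : c v = j.
  by have : v \in [set x | c x == j]; [rewrite Vj set22 | rewrite inE => /eqP].
have Psym : proj j v (u j) = proj j (u j) v by apply: eq_bigr => y _; rewrite mulrC.
have Pdiag : proj j (u j) (u j) + proj j v v = 1.
  have <- : flow Q j = 1 by rewrite (tE j).1 tj.
  rewrite /flow sumV; by congr (_ + _); apply: eq_bigr.
(* [projE] for the constant vector, which A fixes. *)
have Psum : flow A j = \sum_(x | c x == j) \sum_(x' | c x' == j) proj j x x'.
  apply: eq_bigr => x /eqP xj.
  have := projE (fun=> 1) xj; under eq_bigr do rewrite mulr1.
  move=> ->; apply: eq_bigr => y _; under eq_bigr do rewrite mulr1.
  by rewrite Arow mulr1.
have Puv : proj j (u j) v = 0.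
  move: Psum; rewrite flowA -flowQ (tE j).1 tj !sumV Psym => Psum; lra.
(* [projE] for the column of A at u (j + 1), which A maps to a basis vector. *)
have Puu : proj j (u j) (u j) = 1.
  have := projE (fun z => A z (u (j + 1))) (cu j).
  rewrite sumV Puv mul0r addr0; under eq_bigr do rewrite Asq.
  rewrite (bigD1 (u (j + 1))) ?cu //= big1 => [|y /andP[_ /negPf->]].
    by rewrite eqxx mulr1 addr0 -[RHS]mul1r => /(mulIf (Au j)).
  by rewrite mulr0.
have := Qrow (u j).
rewrite (sum_nbr (i := j)) => [|y]; last by move/Qadj; rewrite cu.
rewrite (_ : \sum_(y | c y == j + 1) Q (u j) y = 1); last first.
  by rewrite -Puu; apply: eq_bigr.
move/(canRL (addKr _)); rewrite addNr => /psumr_eq0P nul.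
have : Q (u j) (u i) = 0.
  by apply: nul => [y _|]; rewrite ?sqr_ge0 // cu ji.
by apply/eqP; rewrite expf_eq0 /= Asym.
Qed.
End BlowUp.

(** * Symmetric orthogonal matrices on a triangle-free graph *)

Section Involution.
Variables (R : realFieldType) (T : finType) (A : T -> T -> R).
Hypothesis Asym : forall x y, A x y = A y x.
Hypothesis Asq : forall x y, \sum_z A x z * A z y = (x == y)%:R.
Hypothesis Arow : forall x, \sum_y A x y = 1.
Hypothesis Adiag : forall x, A x x = 0.
Hypothesis Ane1 : forall x y, A x y != 1.
Hypothesis Atri : forall x y z, x != y -> x != z -> y != z ->
  [\/ A x y = 0, A x z = 0 | A y z = 0].

(** The graph of the nonzero entries of A satisfies the hypotheses of
    [pentagon_hom], so an odd closed walk would turn it into a blow-up of a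
    pentagon. *)
Lemma involution_bipartite k : #|T| = (2 * k)%N -> (k <= 6)%N ->
  exists c : T -> bool, forall x y, A x y != 0 -> c x != c y.
Proof.
move=> cT k6; pose e x y := A x y != 0.
have esym : symmetric e by move=> x y; rewrite /e Asym.
have e_neq x y : e x y -> x != y.
  by apply: contraNneq => ->; rewrite Adiag.
have tri x y z : e x y -> e y z -> ~~ e x z.
  move=> xy yz; apply/negP=> xz.
  case: (Atri (e_neq _ _ xy) (e_neq _ _ xz) (e_neq _ _ yz)) => /eqP.
  - exact/negP.
  - exact/negP.
  - exact/negP.
have two_paths x y z : x != y -> e x z -> e y z ->
    exists2 w, w != z & e x w && e y w.
  move=> xy xz yz; apply/exists_inP; apply: contraT; rewrite negb_exists_in.
  move=> /forall_inP none; have := Asq x y; rewrite (negPf xy) (bigD1 z) //=.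
  rewrite big1 => [|w /none]; last first.
    by rewrite negb_and !negbK (Asym w) => /orP[] /eqP->; rewrite ?mul0r ?mulr0.
  by move/eqP; rewrite addr0 mulf_eq0 (Asym z) (negPf xz) (negPf yz).
have no_leaf x y : e x y -> exists2 z, z != y & e x z.
  move=> xy; apply/exists_inP; apply: contraT; rewrite negb_exists_in.
  move=> /forall_inP none; have := Arow x; rewrite (bigD1 y) //= big1 => [|z /none].
    by rewrite addr0 => /eqP; rewrite (negPf (Ane1 x y)).
  by rewrite negbK => /eqP.
have cT12 : (#|T| <= 12)%N by rewrite cT; lia.
apply: (no_odd_closed_walk_bipartite esym) => l x ol; apply/negP => wl.
have [u [uper ue]] := pentagon_of_odd_walk esym tri two_paths cT12 ol wl.
pose v (i : 'I_5) := u i.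
have ve i : e (v i) (v (i + 1)).
  have -> : v (i + 1) = u i.+1; last exact: ue.
  by rewrite /v; case: i => [[|[|[|[|[|//]]]]] ?] //=; rewrite -(uper 0).
have [c [cv cadj]] := pentagon_hom esym tri two_paths no_leaf cT12 ve.
by have := blow_up_gt12 Asym Asq Arow cadj cv ve cT; rewrite ltnNge k6.
Qed.

(** Count the squares of the entries of A between the two colour classes by
    rows and by columns: each row has norm 1. *)
Lemma bipartite_halves (c : T -> bool) : (forall x y, A x y != 0 -> c x != c y) ->
  forall b, (2 * #|[set x | c x == b]| = #|T|)%N.
Proof.
move=> cA; pose m b := #|[set x | c x == b]|.
have half b : \sum_(x | c x == b) \sum_(y | c y == ~~ b) A x y ^+ 2 = (m b)%:R.
  rewrite /m -sum1dep_card natr_sum; apply: eq_bigr => x /eqP xb.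
  transitivity ((x == x)%:R : R); last by rewrite eqxx.
  rewrite -Asq [RHS](bigID (fun y => c y == ~~ b)) /= [X in _ = _ + X]big1 => [|y yb].
    by rewrite addr0; apply: eq_bigr => y _; rewrite (Asym y).
  apply/eqP; apply: contraNT yb; rewrite mulf_eq0 negb_or => /andP[/cA + _].
  by rewrite xb; case: b (c y) {xb} => [] [].
have mm b : m b = m (~~ b).
  apply/eqP; rewrite -(eqr_nat R) -!half exchange_big negbK; apply/eqP.
  by apply: eq_bigr => y _; apply: eq_bigr => x _; rewrite Asym.
move=> b; rewrite mul2n -addnn {2}[#|_|](mm b) -(cardsC [set x | c x == b]).
by congr (_ + _)%N; apply: eq_card => x; rewrite !inE; case: (c x) b => [] [].
Qed.
End Involution.

(** * Tight frames *)

Section TightFrame.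
Variable R : realFieldType.

Lemma mxtrace_mul_tr_ge0 m k (X : 'M[R]_(m, k)) : 0 <= \tr (X *m X^T).
Proof.
apply: sumr_ge0 => i _; rewrite mxE; apply: sumr_ge0 => j _.
by rewrite mxE -expr2 sqr_ge0.
Qed.

Lemma mxtrace_mul_tr_eq0 m k (X : 'M[R]_(m, k)) : \tr (X *m X^T) = 0 -> X = 0.
Proof.
have sq_ge0 i j : 0 <= X i j * X^T j i by rewrite mxE -expr2 sqr_ge0.
have row_ge0 i : 0 <= (X *m X^T) i i by rewrite mxE sumr_ge0.
move=> trX0; apply/matrixP => i j; rewrite mxE; apply/eqP.
have rowi0 : (X *m X^T) i i = 0 by apply: (psumr_eq0P _ trX0).
have Xij0 : X i j * X^T j i = 0.
  by rewrite mxE in rowi0; apply: (psumr_eq0P _ rowi0).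
by move/eqP: Xij0; rewrite mxE mulf_eq0 orbb.
Qed.

(** Write M = Y Y^T = I + A and C = Y^T Y.  The hypotheses say that A has zero
    diagonal and that every product A i j * A j l * A l i vanishes, so
    tr A = tr A^3 = 0.  As C and M have the same power traces,
    tr ((C - 2)^2 (C + 1)) = tr C^3 - 3 tr C^2 + 4 k = 0.  This is the sum of
    the squared norms of C - 2 and of (C - 2) Y^T, and both are zero. *)
Lemma tight_frame N k (Y : 'M[R]_(N, k)) :
    N = (2 * k)%N ->
    (forall i, (Y *m Y^T) i i = 1) ->
    (forall i j l, i != j -> i != l -> j != l ->
       [\/ (Y *m Y^T) i j = 0, (Y *m Y^T) i l = 0 | (Y *m Y^T) j l = 0]) ->
  Y^T *m Y = 2%:M.
Proof.
move=> defN diag1 tri; set M := Y *m Y^T in diag1 tri.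
have symM i j : M i j = M j i.
  by rewrite !mxE; apply: eq_bigr => l _; rewrite !mxE mulrC.
pose A := M - 1%:M; have defM : M = 1%:M + A by rewrite addrC subrK.
have AE i j : A i j = M i j - (i == j)%:R.
  by rewrite [A i j]mxE [fun_of_matrix (- _) i j]mxE [fun_of_matrix 1%:M i j]mxE.
have Aii i : A i i = 0 by rewrite AE eqxx diag1 subrr.
have Aij i j : i != j -> A i j = M i j by move=> ij; rewrite AE (negPf ij) subr0.
have trA : \tr A = 0 by rewrite /mxtrace big1.
have trA3 : \tr (A *m (A *m A)) = 0.
  rewrite /mxtrace big1 // => i _; rewrite mxE big1 // => j _.
  rewrite [fun_of_matrix (_ *m _) j i]mxE mulr_sumr big1 // => l _.
  have [->|ij] := eqVneq i j; first by rewrite Aii mul0r.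
  have [->|jl] := eqVneq j l; first by rewrite Aii mul0r mulr0.
  have [->|il] := eqVneq i l; first by rewrite Aii !mulr0.
  rewrite !Aij ?(eq_sym l) // [M l i]symM.
  by case: (tri i j l ij il jl) => ->; rewrite !(mulr0, mul0r).
clearbody A.
have trM : \tr M = N%:R by rewrite defM mxtraceD mxtrace1 trA addr0.
have trM2 : \tr (M *m M) = N%:R + \tr (A *m A).
  rewrite defM mulmxDl mul1mx mulmxDr mulmx1 !mxtraceD mxtrace1 trA.
  by rewrite !addr0 add0r.
have trM3 : \tr (M *m (M *m M)) = N%:R + 3 * \tr (A *m A).
  rewrite defM !(mulmxDl, mulmxDr, mul1mx, mulmx1) !mxtraceD mxtrace1 trA trA3.
  ring.
set C := Y^T *m Y.
have symC : C^T = C by rewrite /C trmx_mul trmxK.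
have trC : \tr C = N%:R by rewrite mxtrace_mulC.
have trC2 : \tr (C *m C) = \tr (M *m M).
  by rewrite /C /M -mulmxA mxtrace_mulC !mulmxA.
have trC3 : \tr (C *m (C *m C)) = \tr (M *m (M *m M)).
  by rewrite /C /M -!mulmxA mxtrace_mulC !mulmxA.
pose D := C - 2%:M.
have symD : D^T = D by rewrite linearB /= symC tr_scalar_mx.
have trD2 : \tr (D *m D^T) = \tr (C *m C) - 4 * \tr C + 4 * k%:R.
  rewrite symD /D mulmxBl !mulmxBr mul_scalar_mx mul_mx_scalar.
  rewrite -scalar_mxM !linearB /= mxtraceZ mxtrace_scalar.
  rewrite -[(_ * _) *+ k]mulr_natr; ring.
have trDCD : \tr ((D *m Y^T) *m (D *m Y^T)^T) =
    \tr (C *m (C *m C)) - 4 * \tr (C *m C) + 4 * \tr C.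
  rewrite trmx_mul trmxK symD -mulmxA [Y^T *m _]mulmxA -/C.
  rewrite /D mulmxBl !mulmxBr mul_scalar_mx !mul_mx_scalar -!scalemxAr.
  rewrite mul_scalar_mx !linearB /= !mxtraceZ; ring.
have sum0 : \tr (D *m D^T) + \tr ((D *m Y^T) *m (D *m Y^T)^T) = 0.
  rewrite trD2 trDCD trC3 trC2 trM3 trM2 trC.
  have -> : N%:R = 2 * k%:R :> R by rewrite defN natrM.
  ring.
have D0 : \tr (D *m D^T) = 0.
  apply/eqP; rewrite eq_le mxtrace_mul_tr_ge0 andbT.
  have := mxtrace_mul_tr_ge0 (D *m Y^T); lra.
by apply/eqP; rewrite -subr_eq0; apply/eqP/mxtrace_mul_tr_eq0.
Qed.
End TightFrame.

(** * Points on the sphere *)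

Local Open Scope classical_set_scope.

Lemma card_image_set (T : finType) (U : Type) (p : T -> U) (K : {set T}) :
  injective p -> ([set p x | x in [set` K]] #= `I_#|K|)%card.
Proof.
move=> p_inj; apply: card_eq_trans (inj_card_eq _) _; first by move=> x y _ _ /p_inj.
apply/card_set_bijP; exists (fun x => index x (enum K)); split.
- by move=> x /= xK; rewrite cardE index_mem mem_enum.
- move=> x y; rewrite !inE /= => xK yK /(congr1 (nth x (enum K))).
  by rewrite !nth_index ?mem_enum.
move=> i /= iK; have /card_gt0P[x0 _] := leq_ltn_trans (leq0n i) iK.
rewrite cardE in iK; exists (nth x0 (enum K) i); first by rewrite /= -mem_enum mem_nth.
by rewrite index_uniq ?enum_uniq.
Qed.

Lemma card_eq_II_enum (U : Type) (S : set U) N : (S #= `I_N)%card ->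
  exists p : 'I_N -> U, injective p /\ forall x, S x <-> exists i, p i = x.
Proof.
rewrite card_eq_sym => /card_bijP[f [g fK gK]].
pose idx (i : 'I_N) : `I_N := SigSub (mem_set (ltn_ord i : `I_N i)).
exists (fun i => val (f (idx i))); split=> [i j /val_inj|x].
  by move/(can_inj fK) => -[ij]; apply: val_inj.
split=> [Sx|[i <-]]; last exact: set_valP.
pose k := g (SigSub (mem_set Sx)); have kN : (val k < N)%N := set_valP k.
exists (Ordinal kN).
have -> : idx (Ordinal kN) = k by apply: val_inj.
by rewrite gK.
Qed.

(** The squared distance of x and y is 1 - 2 + 1. *)
Lemma dotp_eq1 (R : realType) n (x y : 'rV[R]_n) :
  dotp x x = 1 -> dotp y y = 1 -> dotp x y = 1 -> x = y.
Proof.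
move=> xx yy xy; apply/rowP => i; apply/eqP; rewrite -subr_eq0 -sqrf_eq0.
have sum0 : \sum_(j < n) (x 0 j - y 0 j) ^+ 2 = 0.
  transitivity (dotp x x - 2 * dotp x y + dotp y y).
    rewrite /dotp mulr_sumr -sumrB -big_split /=.
    by apply: eq_bigr => j _; ring.
  rewrite xx yy xy; ring.
by apply/eqP; apply: (psumr_eq0P _ sum0) => // j _; apply: sqr_ge0.
Qed.

Theorem theorem1p4 (R : realType) (n : nat) (hn : (2 <= n <= 5)%N)
    (S : set 'rV[R]_n) (hS : max_obtuse_almost_equiangular S) :
  double_regular_simplex S.
Proof.
case: hS => [[Ssph Stri] cS].
have [p [p_inj Sp]] := card_eq_II_enum cS.
have /andP[n2 n5] := hn.
set N := (2 * n.+1)%N in p p_inj Sp.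
have n0 : 0 < n%:R :> R by rewrite ltr0n; lia.
have n10 : n%:R + 1 != 0 :> R by apply: lt0r_neq0; lra.
have Spi i : S (p i) by apply/Sp; exists i.
have p1 i : dotp (p i) (p i) = 1.
  have /(congr1 (fun x => x ^+ 2)) := Ssph _ (Spi i).
  rewrite /enorm expr1n sqr_sqrtr //.
  by apply: sumr_ge0 => j _; rewrite -expr2 sqr_ge0.
have dotpC (x y : 'rV[R]_n) : dotp x y = dotp y x.
  by apply: eq_bigr => j _; rewrite mulrC.
pose a : R := Num.sqrt (n%:R / (n%:R + 1)).
pose b : R := Num.sqrt (1 / (n%:R + 1)).
have a2 : a ^+ 2 = n%:R / (n%:R + 1) by rewrite sqr_sqrtr // divr_ge0; lra.
have b2 : b ^+ 2 = 1 / (n%:R + 1) by rewrite sqr_sqrtr // divr_ge0; lra.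
have b0 : b != 0.
  by rewrite -sqrf_eq0 b2 mulf_neq0 ?oner_neq0 ?invr_neq0.
(* The scaling by [a] and the last coordinate [b] make the inner product
   -1/n into 0 and keep the points on a sphere of radius 1. *)
pose Y : 'M[R]_(N, n + 1) := row_mx (\matrix_(i, j) (a * p i 0 j)) (const_mx b).
have YE i j : (Y *m Y^T) i j = (n%:R * dotp (p i) (p j) + 1) / (n%:R + 1).
  transitivity (a ^+ 2 * dotp (p i) (p j) + b ^+ 2); last first.
    by rewrite a2 b2; field.
  rewrite /Y tr_row_mx mul_row_col mxE [X in _ + X]mxE big_ord1 !mxE -expr2.
  congr (_ + _); rewrite /dotp mulr_sumr; apply: eq_bigr => k _.
  by rewrite !mxE; ring.
have YI i j : (Y *m Y^T) i j = 0 <-> dotp (p i) (p j) = - 1 / n%:R.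
  rewrite YE; split=> [/eqP|->]; last by field; rewrite n10 lt0r_neq0.
  rewrite mulf_eq0 invr_eq0 (negPf n10) orbF addr_eq0 => /eqP nd.
  by apply: (mulfI (lt0r_neq0 n0)); rewrite nd; field; rewrite lt0r_neq0.
have Y1 i : (Y *m Y^T) i i = 1 by rewrite YE p1 mulr1 divff.
have Ytri i j l : i != j -> i != l -> j != l ->
    [\/ (Y *m Y^T) i j = 0, (Y *m Y^T) i l = 0 | (Y *m Y^T) j l = 0].
  move=> ij il jl.
  have np i' j' : i' != j' -> p i' <> p j' by move=> /eqP + /p_inj.
  case: (Stri _ _ _ (Spi i) (Spi j) (Spi l) (np _ _ ij) (np _ _ il) (np _ _ jl)) => /YI.
  - by constructor 1.
  - by constructor 2.
  - by constructor 3.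
have frame : Y^T *m Y = 2%:M by apply: tight_frame; rewrite ?addn1.
pose A i j := (Y *m Y^T) i j - (i == j)%:R.
have Asym i j : A i j = A j i by rewrite /A !YE dotpC eq_sym.
have MM : (Y *m Y^T) *m (Y *m Y^T) = 2 *: (Y *m Y^T).
  by rewrite mulmxA -(mulmxA Y) frame mul_mx_scalar -scalemxAl.
have Asq i j : \sum_k A i k * A k j = (i == j)%:R.
  pose B := Y *m Y^T - 1%:M.
  have BB : B *m B = 1%:M.
    rewrite mulmxBl !mulmxBr MM !mul1mx !mulmx1 scaler_nat mulr2n addrK opprB.
    by rewrite addrC subrK.
  have AB i' j' : A i' j' = B i' j'.
    by rewrite /B [RHS]mxE [fun_of_matrix (- _) i' j']mxE [fun_of_matrix 1%:M i' j']mxE.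
  have := congr1 (fun X : 'M_N => X i j) BB; rewrite [in RHS]mxE => <-.
  by rewrite [RHS]mxE; apply: eq_bigr => k _; rewrite !AB.
(* The last column of Y is constant, and Y Y^T multiplies columns of Y by 2. *)
have Arow i : \sum_j A i j = 1.
  have Ylast j : Y j (rshift n 0) = b by rewrite row_mxEr mxE.
  have := congr1 (fun X : 'M_(N, n + 1) => X i (rshift n 0)) (mulmxA Y Y^T Y).
  rewrite frame mul_mx_scalar [LHS]mxE Ylast [RHS]mxE.
  under eq_bigr do rewrite Ylast.
  rewrite -mulr_suml => /(mulIf b0) row2.
  rewrite /A sumrB -row2 (bigD1 i) //= eqxx big1 => [|j /negPf].
    by rewrite mulr1n; ring.
  by rewrite eq_sym => ->.
have Adiag i : A i i = 0 by rewrite /A Y1 eqxx subrr.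
have Ane1 i j : A i j != 1.
  have [<-|nij] := eqVneq i j; first by rewrite Adiag eq_sym oner_neq0.
  rewrite /A (negPf nij) subr0 YE; apply: contra nij => /eqP M1.
  apply/eqP/p_inj/dotp_eq1 => //; apply: (mulfI (lt0r_neq0 n0)).
  by have := congr1 ( *%R^~ (n%:R + 1)) M1; rewrite /= divfK //; lra.
have Atri i j l : i != j -> i != l -> j != l ->
  [\/ A i j = 0, A i l = 0 | A j l = 0].
  move=> ij il jl; rewrite /A (negPf ij) (negPf il) (negPf jl) !subr0.
  exact: Ytri.
have [c cA] := involution_bipartite Asym Asq Arow Adiag Ane1 Atri
  (card_ord N) (n5 : n.+1 <= 6)%N.
have half := bipartite_halves Asym Asq cA.
pose C b := [set p i | i in [set` [set i | c i == b]%SET]].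
have simplex d : regular_simplex (C d).
  split.
  - by move=> _ [i _ <-]; apply: Ssph.
  - have := card_image_set [set i | c i == d]%SET p_inj.
    suff -> : #|[set i | c i == d]%SET| = n.+1 by [].
    by apply: double_inj; rewrite -!mul2n half card_ord.
  move=> _ _ [i /= + <-] [j /= + <-]; rewrite !inE => /eqP ci /eqP cj ij.
  apply/YI; have /eqP nij : i <> j by move=> eij; apply: ij; rewrite eij.
  apply/eqP; apply: contraT => Mij; have := cA i j.
  by rewrite /A (negPf nij) subr0 Mij ci cj eqxx => /(_ isT).
exists (C true), (C false); split=> //.
- apply/seteqP; split=> // x [[i + <-] [j + /p_inj ji]] /=.
  by rewrite /= !inE ji => /eqP-> /eqP.
apply/seteqP; split=> x.
  move=> /Sp[i <-]; case ci: (c i); [left|right]; exists i => //;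
    by rewrite /= inE ci.
by case=> -[i _ <-].
Qed.
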